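(* Let $\mathcal{N}$ be a nest on a (real or complex) Banach space $\mathbb{X}$ such that each $N\in\mathcal{N}$ with $N_{-}=N$ is complemented in $\mathbb{X}$. Let $\delta: Alg\,\mathcal{N}\rightarrow Alg\,\mathcal{N}$ be a linear map which is continuous with respect to the strong operator topology. Then: (i) If $\delta(P)=2P\delta(P)$ for every idempotent $P$ in $Alg\,\mathcal{N}$, then $\delta=0$. (ii) If $\delta(P)=2P\delta(P)-P\delta(I)$ for every idempotent $P$ in $Alg\,\mathcal{N}$, then $\delta(a)=a\delta(I)$ for all $a\in Alg\,\mathcal{N}$.
   Context: All vector spaces and algebras are over $\mathbb{F}$, where $\mathbb{F}$ is either $\mathbb{R}$ or $\mathbb{C}$. $\mathcal{B}(\mathbb{X})$ denotes the algebra of all bounded linear operators on the Banach space $\mathbb{X}$. A subspace lattice on $\mathbb{X}$ is a collection of norm-closed subspaces of $\mathbb{X}$ which is closed under arbitrary intersections and arbitrary closed linear spans (denoted $\vee$) and which contains $\{0\}$ and $\mathbb{X}$. A nest $\mathcal{N}$ on $\mathbb{X}$ is a subspace lattice totally ordered by inclusion. The associated nest algebra is $Alg\,\mathcal{N}=\{T\in\mathcal{B}(\mathbb{X}) : T(N)\subseteq N \text{ for all } N\in\mathcal{N}\}$; its identity is denoted $I$. For $N\in\mathcal{N}$, $N_{-}=\vee\{M\in\mathcal{N} : M\subsetneq N\}$ (closed linear span of all elements of $\mathcal{N}$ properly contained in $N$; the span of the empty family is $\{0\}$). A closed subspace is complemented in $\mathbb{X}$ if it has a closed complementary subspace. Continuity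 of $\delta$ means continuity from $Alg\,\mathcal{N}$ with the strong operator topology to $Alg\,\mathcal{N}$ with the strong operator topology. *)

(* Defs.v *)
From HB Require Import structures.
From mathcomp Require Import all_boot all_order all_algebra.
From mathcomp Require Import complex.
From mathcomp Require Import all_classical all_reals all_analysis.

Set Implicit Arguments.
Unset Strict Implicit.
Unset Printing Implicit Defensive.

Import Order.TTheory GRing.Theory Num.Theory.
Import numFieldNormedType.Exports.

Local Open Scope classical_set_scope.
Local Open Scope ring_scope.

Variant scalar_kind := RealScalars | ComplexScalars.

Definition scalars (R : realType) (F : scalar_kind) : numFieldType :=
  match F with
  | RealScalars => R
  | ComplexScalars => (R[i] : numFieldType)
  end.

Section Subspaces.
Context {K : numFieldType} {X : normedModType K}.
Implicit Types (A N : set X) (L : set (set X)).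

Definition is_subspace A :=
  A 0 /\ forall (a : K) x y, A x -> A y -> A (a *: x + y).

Definition closed_subspace A := is_subspace A /\ closed A.

Definition linear_span A : set X :=
  [set x | exists (n : nat) (a : 'I_n -> K) (v : 'I_n -> X),
     (forall i, A (v i)) /\ x = \sum_(i < n) a i *: v i].

Definition closed_span A : set X := closure (linear_span A).

Definition sup_subspaces L : set X := closed_span (\bigcup_(M in L) M).

Definition subspace_lattice L :=
  [/\ L `<=` closed_subspace,
      L [set 0] /\ L [set: X],
      forall L', L' `<=` L -> L (\bigcap_(M in L') M) &
      forall L', L' `<=` L -> L (sup_subspaces L')].

Definition is_nest L :=
  subspace_lattice L /\
  forall M N, L M -> L N -> M `<=` N \/ N `<=` M.

(* [N_-]. *)
Definition nest_pred L N : set X := sup_subspaces [set M | L M /\ M `<` N].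

Definition complemented N :=
  exists M, [/\ closed_subspace M, N `&` M = [set 0] &
                [set x + y | x in N & y in M] = [set: X]].

End Subspaces.

Section BoundedOperators.
Context {K : numFieldType} {X : normedModType K}.

Definition bounded_linear : set (X -> X) :=
  [set T | linear T /\ exists M : K, forall x, `|T x| <= M * `|x|].

End BoundedOperators.

Record bounded_op (K : numFieldType) (X : normedModType K) := BoundedOp {
  bounded_op_fun :> X -> X;
  bounded_opP : bounded_op_fun \in bounded_linear
}.

Section BoundedOpAlgebra.
Context {K : numFieldType} {X : normedModType K}.
Local Notation BX := (bounded_op X).

HB.instance Definition _ := [isSub for @bounded_op_fun K X].
HB.instance Definition _ := [Choice of BX by <:].

Lemma bounded_linear_submod : subsemimod_closed (mem (@bounded_linear K X)).
Proof.
split; first split.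
- rewrite inE; split; first by move=> a x y; rewrite scaler0 addr0.
  by exists 0 => x; rewrite normr0 mul0r.
- move=> S T; rewrite !inE => -[linS [M SM]] [linT [M' TM']]; split.
    move=> a x y; rewrite !fctE linS linT scalerDr.
    by rewrite addrACA.
  exists (M + M') => x; rewrite mulrDl.
  by rewrite (le_trans (ler_normD _ _))// lerD.
- move=> a T; rewrite !inE => -[linT [M TM]]; split.
    move=> b x y; rewrite !fctE linT scalerDr !scalerA.
    by rewrite mulrC.
  exists (`|a| * M) => x.
  by rewrite !fctE normrZ -mulrA ler_wpM2l.
Qed.

HB.instance Definition _ := GRing.SubChoice_isSubLmodule.Build K (X -> X)
  (mem (@bounded_linear K X)) BX bounded_linear_submod.

Lemma bounded_op_linear (T : BX) : linear T.
Proof. by have := bounded_opP T; rewrite inE => -[]. Qed.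

HB.instance Definition _ (T : BX) :=
  GRing.isLinear.Build K X X *:%R T (bounded_op_linear T).

Lemma bounded_linear_id : idfun \in @bounded_linear K X.
Proof. by rewrite inE; split => //; exists 1 => x; rewrite mul1r. Qed.

Lemma bounded_linear_comp (S T : BX) : S \o T \in @bounded_linear K X.
Proof.
have [+ +] := (bounded_opP S, bounded_opP T).
rewrite !inE => -[linS [M SM]] [linT [M' TM']]; split.
  by move=> a x y; rewrite /= linT linS.
have [[x0 x0_neq0]|X0] := pselect (exists x : X, x != 0); last first.
  exists 0 => x; have -> : x = 0.
    by apply/eqP/negPn/negP => x_neq0; apply: X0; exists x.
  by rewrite /= !linear0 normr0 mulr0.
have M_ge0 : 0 <= M.
  rewrite -(pmulr_lge0 (x := `|x0|)) ?normr_gt0//.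
  exact: le_trans (SM x0).
by exists (M * M') => x /=; rewrite (le_trans (SM _))// -mulrA ler_wpM2l.
Qed.

Definition op_id : BX := BoundedOp bounded_linear_id.
Definition op_comp (S T : BX) : BX := BoundedOp (bounded_linear_comp S T).

Let op_compA : associative op_comp.
Proof. by move=> S T U; exact/val_inj. Qed.
Let op_comp1o : left_id op_id op_comp.
Proof. by move=> T; exact/val_inj. Qed.
Let op_compo1 : right_id op_id op_comp.
Proof. by move=> T; exact/val_inj. Qed.
Let op_compDl : left_distributive op_comp +%R.
Proof. by move=> S T U; exact/val_inj. Qed.
Let op_compDr : right_distributive op_comp +%R.
Proof. by move=> S T U; apply/val_inj/funext => x /=; rewrite !fctE /= linearD. Qed.

(* Only the [pzRingType] structure is available since [X] may be zero. *)
HB.instance Definition _ := GRing.Zmodule_isPzRing.Build BX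
  op_compA op_comp1o op_compo1 op_compDl op_compDr.

End BoundedOpAlgebra.

Record nest (K : numFieldType) (X : normedModType K) := Nest {
  nest_family :> set X -> Prop;
  nestP : is_nest nest_family
}.

Definition leaves_invariant (K : numFieldType) (X : normedModType K)
    (L : nest X) : set (bounded_op X) :=
  [set T | forall N, L N -> T @` N `<=` N].

Record nest_alg (K : numFieldType) (X : normedModType K) (L : nest X) :=
  NestAlg {
    nest_alg_op :> bounded_op X;
    nest_algP : nest_alg_op \in leaves_invariant L
  }.

Section NestAlgebra.
Context {K : numFieldType} {X : normedModType K} (L : nest X).

HB.instance Definition _ := [isSub for @nest_alg_op K X L].
HB.instance Definition _ := [Choice of nest_alg L by <:].

Let nest_subspace N : L N -> is_subspace N.
Proof. by have [[+ _ _ _] _] := nestP L => /[apply] -[]. Qed.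

Lemma leaves_invariant_submod :
  subsemimod_closed (mem (leaves_invariant L)).
Proof.
split; first split.
- rewrite inE => N /nest_subspace[N0 _] _ [x _ <-].
  exact: N0.
- move=> S T; rewrite !inE => invS invT N LN _ [x Nx <-].
  have [_ linN] := nest_subspace LN.
  rewrite -[_ x]/(S x + T x) -[S x]scale1r; apply: linN.
    by apply: invS => //; exists x.
  by apply: invT => //; exists x.
- move=> a T; rewrite !inE => invT N LN _ [x Nx <-].
  have [N0 linN] := nest_subspace LN.
  rewrite -[_ x]/(a *: T x) -[a *: T x]addr0; apply: linN => //.
  by apply: invT => //; exists x.
Qed.

Lemma leaves_invariant_subring : subring_closed (mem (leaves_invariant L)).
Proof.
split; first by rewrite inE => N _ _ [x Nx <-].
  by have [] := GRing.subsemimod_closedB leaves_invariant_submod.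
move=> S T; rewrite !inE => invS invT N LN _ [x Nx <-].
rewrite -[_ x]/(S (T x)); apply: invS => //; exists (T x) => //.
by apply: invT => //; exists x.
Qed.

HB.instance Definition _ := GRing.SubChoice_isSubLmodule.Build K (bounded_op X)
  (mem (leaves_invariant L)) (nest_alg L) leaves_invariant_submod.
HB.instance Definition _ := GRing.SubZmodule_isSubPzRing.Build (bounded_op X)
  (mem (leaves_invariant L)) (nest_alg L) leaves_invariant_subring.

End NestAlgebra.

(* The strong operator topology on B(X) is the topology of pointwise
   convergence; [nest_sot L] is Alg L with the topology it induces. *)
Definition op_sot (K : numFieldType) (X : normedModType K) : topologicalType :=
  initial_topology (@bounded_op_fun K X : bounded_op X -> {ptws X -> X}).

Definition nest_sot (K : numFieldType) (X : normedModType K) (L : nest X) :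
    topologicalType :=
  initial_topology (@nest_alg_op K X L : nest_alg L -> op_sot X).

(* Main.v *)
Require Import Defs.
From HB Require Import structures.
From mathcomp Require Import all_boot all_order all_algebra.
From mathcomp Require Import complex.
From mathcomp Require Import all_classical all_reals all_analysis.
From mathcomp Require Import ring lra.

Set Implicit Arguments.
Unset Strict Implicit.
Unset Printing Implicit Defensive.

Import Order.TTheory GRing.Theory Num.Theory.
Import numFieldNormedType.Exports.

Local Open Scope classical_set_scope.
Local Open Scope ring_scope.

(** Multiplying the identity for an idempotent [P] on the left by [P] gives
    [P delta(P) = 0] in case (i) and [P delta(P) = P delta(I)] in case (ii); so
    [delta(P) = P c] with [c = 0], resp. [c = delta(I)]. Both sides are linear
    and SOT-continuous, so it suffices that the idempotents of [Alg L] span an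
    SOT-dense subspace.

    Density is proved by induction on the finite set of test vectors. The new
    vector [x] may be changed modulo the span [V] of the previous ones to a [w]
    lying in every member of the nest that meets [x + V]. Then [w] is not in
    [M + V] for any [M] in the nest with [w] not in [M], and Hahn-Banach yields
    [f] vanishing on [M] and [V] with [f(w) = 1]; the operator [f(-) y] corrects
    the value at [w] without touching [V]. With [N] the least member of the nest
    containing [w], one takes [M = N_-] if [w] is not in [N_-], and otherwise
    [M] strictly inside [N] containing a good approximation [y] of the target
    value. Such rank-one operators are combinations of idempotents; the
    complementation hypothesis enters when [f] vanishes on the least [N]
    containing [y] and [N_- = N], for then the projection [P] onto [N]
    (bounded by the closed graph theorem) and [P + f(-) y] are idempotents of
    [Alg L]. *)

(** * Hahn-Banach extension of dominated linear graphs *)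

Section HahnBanach.
Context {R : realType} {V : lmodType R} (p : V -> R).
Hypothesis p_subadd : forall x y, p (x + y) <= p x + p y.
Hypothesis p_poshom : forall a x, 0 < a -> p (a *: x) = a * p x.
Implicit Types (G : set (V * R^o)).

(** Partial functionals are encoded as graphs ordered by inclusion, which suits Zorn's lemma;
    domination by [p] makes such a graph single-valued. *)
Definition dominated_graph G :=
  [/\ G 0, forall a z w, G z -> G w -> G (a *: z + w)
    & forall z, G z -> z.2 <= p z.1].

(** The value [c] at [x] must satisfy [r - p (z - x) <= c <= p (z + x) - r] for all [(z, r)] in [G].
    By subadditivity each lower bound is below each upper one, so the supremum of the lower bounds
    serves. *)
Lemma dominated_graph_extend G x : dominated_graph G ->
  exists c G', [/\ dominated_graph G', G `<=` G' & G' (x, c)].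
Proof.
move=> [G0 Glin Gp].
pose S := [set z.2 - p (z.1 - x) | z in G].
have S_ub y s : G (y, s) -> ubound S (p (y + x) - s).
  move=> Gy _ [[z r] Gz <-] /=.
  have := Gp _ (Glin 1 _ _ Gz Gy).
  rewrite scale1r /= => H.
  have := p_subadd (z - x) (y + x).
  rewrite (addrC y) addrA subrK => H'.
  by rewrite lerBrDr addrAC lerBlDl (le_trans H).
have S_sup : has_sup S.
  split; first by exists (0 - p (0 - x)); exists 0.
  by exists (p (0 + x) - 0); apply: S_ub.
pose c := sup S; exists c.
have c_ge z r : G (z, r) -> r - p (z - x) <= c.
  by move=> Gz; apply: ub_le_sup; [case: S_sup | exists (z, r)].
have c_le z r : G (z, r) -> c <= p (z + x) - r.
  by move=> Gz; apply: ge_sup; [case: S_sup | apply: S_ub].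
exists [set w | exists z t, G z /\ w = z + t *: (x, c : R^o)]; split.
- split.
  + by exists 0, 0; split=> //; rewrite scale0r addr0.
  + move=> a _ _ [z [t [Gz ->]]] [z' [t' [Gz' ->]]].
    exists (a *: z + z'), (a * t + t'); split; first exact: Glin.
    by rewrite scalerDr scalerDl scalerA addrACA.
  + move=> _ [[z r] [t [Gz ->]]] /=.
    have Gs a : G (a *: z, a * r).
      by rewrite -[(_, _)]addr0; apply: (Glin a (z, r)).
    (* Dividing by [|t|] turns domination at [z + t *: x] into [c_le] for positive [t] and [c_ge]
       for negative [t]. *)
    have [t_lt0|t_gt0|->] := ltgtP t 0; last first.
    * by rewrite !scale0r !addr0; apply: Gp Gz.
    * have /c_le := Gs t^-1.
      have -> : z + t *: x = t *: (t^-1 *: z + x).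
        by rewrite scalerDr scalerA divff ?gt_eqF// scale1r.
      rewrite p_poshom// lerBrDr -(ler_pM2l t_gt0) mulrDr mulrA divff ?gt_eqF//.
      by rewrite mul1r addrC.
    * have s_gt0 : 0 < - t by rewrite oppr_gt0.
      have /c_ge := Gs (- t)^-1.
      have -> : z + t *: x = (- t) *: ((- t)^-1 *: z - x).
        by rewrite scalerBr scalerA divff ?gt_eqF// scale1r scaleNr opprK.
      rewrite p_poshom// lerBlDr -(ler_pM2l s_gt0) mulrA divff ?gt_eqF// mul1r.
      rewrite mulrDr -[t *: c]/(t * c); lra.
- by move=> z Gz; exists z, 0; rewrite scale0r addr0.
- by exists 0, 1; rewrite scale1r add0r.
Qed.

(** By linearity [(0, r - s)] is in the graph, so [r - s <= p 0 = 0]; the roles of [r] and [s] are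
    symmetric. *)
Lemma dominated_graph_fun G x r s : dominated_graph G ->
  G (x, r) -> G (x, s) -> r = s.
Proof.
move=> [G0 Glin Gp].
suff le_rs r' s' : G (x, r') -> G (x, s') -> r' <= s'.
  by move=> Gr Gs; apply/eqP; rewrite eq_le !le_rs.
move=> Gr Gs.
have p0 : p 0 = 0.
  have := p_poshom 0 (ltr0Sn R 1); rewrite scaler0; lra.
have /Gp := Glin (- 1) _ _ Gs Gr.
by rewrite /= !scaleN1r addNr p0 addrC subr_le0.
Qed.

Theorem Hahn_Banach G : dominated_graph G ->
  exists f : {scalar V}, (forall z, G z -> f z.1 = z.2) /\ forall x, f x <= p x.
Proof.
move=> domG.
pose extends H := H = set0 \/ (dominated_graph H /\ G `<=` H).
have [Fs extF totF|H [+ Hmax]] := @Zorn_bigcup _ extends.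
  have [[H [FH H_neq0]]|F0] := pselect (exists H, Fs H /\ H <> set0); last first.
    left; apply/seteqP; split=> // z [H FH Hz]; apply: F0.
    by exists H; split=> // H0; rewrite H0 in Hz.
  have domF H' z : Fs H' -> H' z -> dominated_graph H' /\ G `<=` H'.
    by move=> /extF[->|].
  have [/H_neq0|[domH GH]] := extF _ FH; first by [].
  right; split; last by move=> z /GH Hz; exists H.
  split; first by exists H => //; case: domH.
    move=> a z w [H1 F1 z1] [H2 F2 w2].
    have [|] := totF _ _ F1 F2 => [H12|H21].
      have [[_ lin _] _] := domF _ _ F2 w2.
      by exists H2 => //; apply: lin => //; apply: H12.
    have [[_ lin _] _] := domF _ _ F1 z1.
    by exists H1 => //; apply: lin => //; apply: H21.
  by move=> z [H1 F1 z1]; have [[_ _ +] _] := domF _ _ F1 z1; apply.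
case=> [H0|[domH GH]].
  exfalso; apply: (Hmax G); last by right; split.
  by rewrite H0; split; [exact: sub0set | move=> G0; case: domG => /G0].
have totH x : exists r, H (x, r).
  have [c [H' [domH' HH' xc]]] := dominated_graph_extend x domH.
  have [H'H|nH'H] := pselect (H' `<=` H); first by exists c; apply: H'H.
  by exfalso; apply: (Hmax H') => //; right; split=> //; apply: subset_trans HH'.
have [f Hf] := choice totH.
have flin : linear_for *%R f.
  move=> a x y; apply: dominated_graph_fun (Hf _) _ => //.
  by case: domH => _ lin _; apply: (lin a (x, f x) (y, f y)).
pose F := GRing.isLinear.Build _ _ _ _ f flin.
pose fL : {scalar V} := HB.pack f F.
exists fL; split.
- by move=> [x r] /GH Hx; apply: dominated_graph_fun Hx.
- by move=> x; case: domH => _ _ /(_ _ (Hf x)).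
Qed.

End HahnBanach.

(** * Closed graph theorem for complete seminorms *)

Section ClosedGraph.
Context {R : realType}.

Definition seminorm (V : lmodType R) (p : V -> R) :=
  (forall x y, p (x + y) <= p x + p y) /\ forall a x, p (a *: x) = `|a| * p x.

(** Completeness in the form that iterative constructions use: [2 * d n] bounds the tail
    [d n + d n / 2 + d n / 4 + ...]. *)
Definition geometric_complete (V : lmodType R) (p : V -> R) :=
  forall (x : nat -> V) (d : nat -> R),
    (forall n, p (x n.+1 - x n) <= d n) -> (forall n, d n.+1 <= d n / 2) ->
  exists l, forall n, p (x n - l) <= 2 * d n.

Section Seminorm.
Context {V : lmodType R} (p : V -> R).
Hypothesis p_seminorm : seminorm p.

Lemma seminorm0 : p 0 = 0.
Proof. by case: p_seminorm => _ /(_ 0 0); rewrite scaler0 normr0 mul0r. Qed.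

Lemma seminormN x : p (- x) = p x.
Proof. by case: p_seminorm => _ /(_ (-1) x); rewrite scaleN1r normrN1 mul1r. Qed.

Lemma seminorm_ge0 x : 0 <= p x.
Proof.
case: p_seminorm => /(_ x (- x)) + _.
by rewrite subrr seminorm0 seminormN -mulr2n pmulrn_lge0.
Qed.

Lemma seminormB x y : p (x - y) <= p x + p y.
Proof. by case: p_seminorm => /(_ x (- y)); rewrite seminormN. Qed.

End Seminorm.

Lemma geometric_lt (a e : R) : 0 < e -> exists n, a / 2 ^+ n < e.
Proof.
move=> e_gt0; exists (Num.truncn (a / e)).+1.
rewrite ltr_pdivrMr ?exprn_gt0// mulrC -ltr_pdivrMr//.
apply: lt_trans (truncnS_gt _) _.
by rewrite -natrX ltr_nat ltn_expl.
Qed.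

Section ClosedGraphTheorem.
Context {V W : lmodType R} (p : V -> R) (q : W -> R) (T : {linear V -> W}).
Hypotheses (p_seminorm : seminorm p) (q_seminorm : seminorm q).
Hypotheses (p_complete : geometric_complete p) (q_complete : geometric_complete q).

(* Baire category argument, run directly on a sequence of nested balls. *)
Lemma sublevel_somewhere_dense : exists (k : nat) x0 r, 0 < r /\
  forall x, p (x - x0) < r -> forall e, 0 < e ->
    exists z, p (x - z) < e /\ q (T z) <= k%:R.
Proof.
apply: contrapT => noball.
(* The state is an index [k] with a centre and a radius; the new ball has at most half the radius,
   and [q (T z)] exceeds [k] on it. *)
have step (t : nat * (V * R)) : exists t' : V * R, 0 < t.2.2 ->
    [/\ p (t'.1 - t.2.1) <= t.2.2 / 2, 0 < t'.2, t'.2 <= t.2.2 / 2 &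
        forall z, p (t'.1 - z) <= t'.2 -> t.1%:R < q (T z)].
  case: t => k [x r] /=.
  have [r_gt0|] := ltP 0 r; last by exists (0, 0).
  apply: contrapT => nostep; apply: noball; exists k, x, (r / 2).
  split=> [|x' x'x e e_gt0]; first by rewrite divr_gt0.
  apply: contrapT => noz; apply: nostep.
  exists (x', Num.min (r / 2) (e / 2)) => _ /=; split.
  - exact: ltW.
  - by rewrite lt_min !divr_gt0.
  - by rewrite ge_min lexx.
  - move=> z; rewrite le_min => /andP[_ zx'].
    rewrite ltNge; apply/negP => qTz; apply: noz; exists z; split=> //.
    by apply: le_lt_trans zx' _; rewrite ltr_pdivrMr// ltr_pMr// ltr1n.
have [g gP] := choice step.
pose fix s n := if n is m.+1 then g (m, s m) else (0, 1).
have r_gt0 n : 0 < (s n).2.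
  elim: n => [|n IHn] /=; first exact: ltr01.
  by have [] := gP (n, s n) IHn.
have sP n := gP (n, s n) (r_gt0 n).
have [|n|l lP] := p_complete (x := fun n => (s n).1) (d := fun n => (s n).2 / 2).
- by move=> n; have [] := sP n.
- by rewrite ler_wpM2r//; have [] := sP n.
(* The limit of the centres lies in all the balls, so [q (T l)] exceeds every natural number. *)
have qTl n : n%:R < q (T l).
  have [_ _ _] := sP n; apply; apply: le_trans (lP n.+1) _.
  by rewrite mulrCA divff ?mulr1.
have := qTl (Num.truncn (q (T l))).+1.
by move=> /(lt_trans (truncnS_gt _)); rewrite ltxx.
Qed.

(** Subtracting approximations of [x0] and of [x0 + c *: x] moves the density of a sublevel set from
    around [x0] to around the origin. *)
Lemma almost_open : exists C, 0 <= C /\ forall s x, 0 < s -> p x <= s ->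
  exists z, p (x - z) <= s / 2 /\ q (T z) <= C * s.
Proof.
have [k [x0 [r [r_gt0 dense]]]] := sublevel_somewhere_dense.
exists (4 * k%:R / r); split; first by rewrite divr_ge0 ?mulr_ge0 ?(ltW r_gt0).
move=> s x s_gt0 px.
have e_gt0 : 0 < r / 8 by rewrite divr_gt0.
have [|z0 [z0x0 qz0]] := dense x0 _ _ e_gt0.
  by rewrite subrr seminorm0.
(* The factor [c] shrinks [x] to seminorm at most [r / 2], inside the ball; [c'] undoes it and turns
   the two errors [r / 8] into [s / 2]. *)
pose c := r / (2 * s); pose c' := 2 * s / r.
have cc' : c' * c = 1 by rewrite /c /c'; field; rewrite !gt_eqF.
have c_gt0 : 0 < c by rewrite divr_gt0 ?mulr_gt0.
have c'_gt0 : 0 < c' by rewrite divr_gt0 ?mulr_gt0.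
have [|z1 [z1x0 qz1]] := dense (x0 + c *: x) _ _ e_gt0.
  rewrite addrAC subrr add0r p_seminorm.2 gtr0_norm//.
  apply: le_lt_trans (ler_wpM2l (ltW c_gt0) px) _.
  have -> : c * s = r / 2 by rewrite /c; field; rewrite gt_eqF.
  by rewrite ltr_pdivrMr// ltr_pMr// ltr1n.
exists (c' *: (z1 - z0)); split.
- have -> : x - c' *: (z1 - z0) = c' *: ((x0 + c *: x - z1) - (x0 - z0)).
    have -> : x0 + c *: x - z1 - (x0 - z0) = c *: x - (z1 - z0).
      by rewrite -(addrA x0) !opprB [LHS]addrC subrKA addrCA.
    by rewrite [RHS]scalerBr scalerA cc' scale1r.
  rewrite p_seminorm.2 gtr0_norm//.
  have /(ler_wpM2l (ltW c'_gt0)) := seminormB p_seminorm (x0 + c *: x - z1) (x0 - z0).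
  move=> /le_trans; apply.
  have -> : s / 2 = c' * (r / 4) by rewrite /c'; field; rewrite gt_eqF.
  by rewrite ler_pM2l//; lra.
- rewrite linearZ/= q_seminorm.2 gtr0_norm// linearB.
  have -> : 4 * k%:R / r * s = c' * (2 * k%:R) by rewrite /c'; field; rewrite gt_eqF.
  rewrite ler_pM2l//; apply: le_trans (seminormB q_seminorm _ _) _; lra.
Qed.

(** Iterating [almost_open] on the remainders [u n] makes [p (u n)] decay geometrically while
    [T (u n)] converges to some [y]. Closedness gives [q y = 0], so [q (T x)] is bounded by the sum
    of the steps. *)
Theorem closed_graph :
  (forall y, (forall e, 0 < e -> exists x, p x < e /\ q (T x - y) < e) -> q y = 0) ->
  exists C, forall x, q (T x) <= C * p x.
Proof.
move=> closedT; have [C [C_ge0 Copen]] := almost_open.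
have bound s x : 0 < s -> p x <= s -> q (T x) <= 2 * C * s.
  move=> s_gt0 px.
  have step (t : nat * V) : exists z, p t.2 <= s / 2 ^+ t.1 ->
      p (t.2 - z) <= s / 2 ^+ t.1.+1 /\ q (T z) <= C * (s / 2 ^+ t.1).
    have [pt|] := leP (p t.2) (s / 2 ^+ t.1); last by exists 0.
    have [|z [zt qz]] := Copen _ _ _ pt; first by rewrite divr_gt0 ?exprn_gt0.
    exists z => _; split=> //; apply: le_trans zt _.
    by rewrite exprSr invfM mulrA.
  have [g gP] := choice step.
  pose fix u n := if n is m.+1 then u m - g (m, u m) else x.
  have pu n : p (u n) <= s / 2 ^+ n.
    elim: n => [|n IHn]; first by rewrite expr0 divr1.
    by have [] := gP (n, u n) IHn.
  have [||y yP] := q_complete (x := fun n => T (u n)) (d := fun n => C * s / 2 ^+ n).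
  - move=> n /=; rewrite linearB addrAC subrr add0r seminormN// -mulrA.
    by have [] := gP (n, u n) (pu n).
  - by move=> n; rewrite exprSr invfM !mulrA.
  have qy : q y = 0.
    apply: closedT => e e_gt0.
    have [n nP] := geometric_lt (s + 2 * (C * s)) e_gt0.
    have Cs_ge0 : 0 <= 2 * (C * s) / 2 ^+ n.
      by rewrite divr_ge0 ?exprn_ge0 ?mulr_ge0// ltW.
    have s_ge0 : 0 <= s / 2 ^+ n by rewrite divr_ge0 ?exprn_ge0// ltW.
    rewrite mulrDl in nP.
    exists (u n); split; first by have := pu n; lra.
    by have := yP n; rewrite mulrA; lra.
  have := yP 0; rewrite expr0 divr1 mulrA /= => le0.
  have := q_seminorm.1 (T x - y) y; rewrite subrK qy addr0 => /le_trans; exact.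
exists (2 * C) => x.
have [px_gt0|] := ltP 0 (p x); first exact: bound.
move=> px_le0; have -> : p x = 0 by apply/eqP; rewrite eq_le px_le0 seminorm_ge0.
(* When [p x = 0], every positive [s] is allowed in [bound]; [s = q (T x) / (2 * C + 1)] gives a
   contradiction. *)
rewrite mulr0 leNgt; apply/negP => q_gt0.
have C_gt0 : 0 < 2 * C + 1 by rewrite ltr_wpDl ?mulr_ge0.
have := bound (q (T x) / (2 * C + 1)) x.
rewrite divr_gt0// => /(_ isT).
move=> /(_ (le_trans px_le0 (ltW (divr_gt0 q_gt0 C_gt0)))).
rewrite mulrA ler_pdivlMr// mulrC ler_pM2r//; lra.
Qed.

End ClosedGraphTheorem.
End ClosedGraph.

(** * Real and complex scalars *)

(** Restriction of scalars along [iota], through which the real theorems above apply to spaces over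
    either field. *)
Definition realification (R : realType) (K : numFieldType)
  (iota : {rmorphism R -> K}) (V : lmodType K) : Type := V.

Section Realification.
Context {R : realType} {K : numFieldType} (iota : {rmorphism R -> K}).
Variable V : lmodType K.
Local Notation VR := (realification iota V).

HB.instance Definition _ := GRing.Zmodule.copy VR V.

Let scale (a : R) (x : VR) : VR := iota a *: (x : V).

Let scaleA a b x : scale a (scale b x) = scale (a * b) x.
Proof. by rewrite /scale scalerA rmorphM. Qed.
Let scale1 : left_id 1 scale.
Proof. by move=> x; rewrite /scale rmorph1 scale1r. Qed.
Let scaleDr : right_distributive scale +%R.
Proof. by move=> a x y; rewrite /scale scalerDr. Qed.
Let scaleDl x : {morph scale^~ x : a b / a + b}.
Proof. by move=> a b; rewrite /scale rmorphD scalerDl. Qed.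

HB.instance Definition _ :=
  GRing.Zmodule_isLmodule.Build R VR scaleA scale1 scaleDr scaleDl.

Lemma realification_scaleE (a : R) (x : VR) : a *: x = iota a *: (x : V).
Proof. by []. Qed.

End Realification.

Section Scalars.
Context {R : realType}.

Definition of_real F : R -> scalars R F :=
  match F with RealScalars => fun r => r | ComplexScalars => fun r => r%:C%C end.

Definition real_part F : scalars R F -> R :=
  match F with RealScalars => fun r => r | ComplexScalars => fun z => complex.Re z end.

Variable F : scalar_kind.
Local Notation K := (scalars R F).

Let of_real_zmod : zmod_morphism (@of_real F).
Proof. by case: F => // a b /=; rewrite rmorphB. Qed.
Let of_real_monoid : monoid_morphism (@of_real F).
Proof. by case: F; split=> // a b /=; rewrite rmorphM. Qed.

HB.instance Definition _ := GRing.isZmodMorphism.Build R K (@of_real F) of_real_zmod.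
HB.instance Definition _ := GRing.isMonoidMorphism.Build R K (@of_real F) of_real_monoid.

Let real_part_zmod : zmod_morphism (@real_part F).
Proof. by case: F => // -[a b] [c d]. Qed.
HB.instance Definition _ := GRing.isZmodMorphism.Build K R (@real_part F) real_part_zmod.

Lemma of_realK : cancel (@of_real F) (@real_part F).
Proof. by case: F. Qed.

Lemma ler_of_real (a b : R) : (of_real F a <= of_real F b) = (a <= b).
Proof. by case: F => //; rewrite /= lecR. Qed.

Lemma ltr_of_real (a b : R) : (of_real F a < of_real F b) = (a < b).
Proof. by case: F => //; rewrite /= ltcR. Qed.

Lemma real_partK (z : K) : 0 <= z -> of_real F (real_part z) = z.
Proof. by case: F z => // -[a b]; rewrite lecE /= => /andP[/eqP -> _]. Qed.

Lemma real_part_gt0 (z : K) : 0 < z -> 0 < real_part z.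
Proof. by move=> z_gt0; rewrite -ltr_of_real rmorph0 real_partK// ltW. Qed.

(** The norm is an element of [K], possibly complex by type; seminorms take values in [R]. *)
Definition real_norm (X : normedModType K) (x : X) : R := real_part `|x|.

Lemma real_normE (X : normedModType K) (x : X) : `|x| = of_real F (real_norm x).
Proof. by rewrite real_partK. Qed.

Lemma normr_of_real (a : R) : `|of_real F a| = of_real F `|a|.
Proof. by case: F => //=; rewrite normc_def /= expr0n addr0 sqrtr_sqr. Qed.

Lemma real_norm_seminorm (X : normedModType K) :
  seminorm (@real_norm X : realification (of_real F) X -> R).
Proof.
split=> [x y|a x]; rewrite /real_norm.
  by rewrite -ler_of_real rmorphD /= !real_partK//; exact: ler_normD.
apply: (can_inj of_realK).
by rewrite rmorphM /= !real_partK// realification_scaleE normrZ normr_of_real.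
Qed.

Lemma real_norm_complete (X : completeNormedModType K) :
  geometric_complete (@real_norm X : realification (of_real F) X -> R).
Proof.
pose p : realification (of_real F) X -> R := @real_norm X.
have p_seminorm : seminorm p by exact: real_norm_seminorm.
move=> x d xd d2.
have d_ge0 n : 0 <= d n by apply: le_trans (xd n); apply: seminorm_ge0.
have xdk k : forall n, p (x (n + k)%N - x n) <= 2 * d n.
  elim: k => [|k IHk] n.
    by rewrite addn0 subrr seminorm0// mulr_ge0.
  (* The first step is split off, since [2 * d n.+1 + d n <= 2 * d n]. *)
  have := p_seminorm.1 (x (n + k.+1)%N - x n.+1) (x n.+1 - x n).
  rewrite subrKA => /le_trans; apply.
  have := IHk n.+1; rewrite addSnnS => xk.
  have := d2 n; have := xd n; rewrite -/(p _) => dn dn1.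
  by apply: le_trans (lerD xk dn) _; lra.
have dn n : d n <= d 0 / 2 ^+ n.
  elim: n => [|n IHn]; first by rewrite expr0 divr1.
  by apply: le_trans (d2 n) _; rewrite exprSr invfM mulrA ler_wpM2r.
have small (e : R) : 0 < e -> exists n, forall m, (n <= m)%N -> 2 * d m < e.
  move=> /(geometric_lt (2 * d 0))[n nP]; exists n => m nm.
  apply: le_lt_trans nP; rewrite -mulrA ler_wpM2l//.
  apply: le_trans (dn m) _; rewrite ler_wpM2l// lef_pV2 ?posrE ?exprn_gt0//.
  by rewrite ler_weXn2l// ler1n.
have near_x n m : (n <= m)%N -> p (x m - x n) <= 2 * d n.
  by move=> /subnKC <-; apply: xdk.
have ltK (e : K) (y : X) : 0 < e -> real_norm y < real_part e -> `|y| < e.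
  by move=> e_gt0; rewrite -ltr_of_real /real_norm !real_partK// ltW.
have /cvg_ex[l xl] : cvg ((x : nat -> X) @ \oo).
  apply: cauchy_cvg; apply: cauchy_exP => e e_gt0.
  have [n nP] := small _ (real_part_gt0 e_gt0).
  exists (x n); exists n => // m /= nm.
  rewrite -ball_normE /= distrC; apply: ltK => //.
  by apply: le_lt_trans (near_x n m nm) (nP n (leqnn n)).
exists l => n; apply/ler_addgt0Pr => e e_gt0.
have eK_gt0 : 0 < of_real F e by rewrite -(rmorph0 (@of_real F)) ltr_of_real.
have /cvgrPdist_lt/(_ _ eK_gt0)[m _ mP] := xl.
have := mP (maxn n m) (leq_maxr n m).
rewrite /= real_normE ltr_of_real => lx.
have := seminormB p_seminorm (x (maxn n m) - l) (x (maxn n m) - x n).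
rewrite opprB addrC subrKA => /le_trans; apply; rewrite addrC.
apply: lerD; first exact/near_x/leq_maxl.
by rewrite /p /real_norm distrC ltW.
Qed.

End Scalars.

(** * Bounded functionals over [K] and separation from closed subspaces *)

Section Functionals.
Context {R : realType} {F : scalar_kind}.
Local Notation K := (scalars R F).

Lemma real_part_functional (X : lmodType K)
    (u : {scalar realification (of_real F) X}) :
  exists f : {scalar X}, forall x, real_part (f x) = u x.
Proof.
have uD (x y : X) : u (x + y) = u x + u y by exact: (linearD u).
have uZ (a : R) (x : X) : u (of_real F a *: x) = a * u x by exact: (linearZ_LR u).
suff [f [f_lin fE]] : exists f : X -> K, linear_for *%R f /\
    forall x, real_part (f x) = u x.
  pose fM := GRing.isLinear.Build _ _ _ _ f f_lin.
  by exists (HB.pack f fM : {scalar X}).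
clear -uD uZ; move: (u : X -> R) uD uZ; clear u.
case: F X => X u uD uZ; first by exists u; split=> // a x y; rewrite uD uZ.
have uZr (a : R) (x : X) : u (a%:C%C *: x) = a * u x by exact: uZ.
(* A complex functional is recovered from its real part [u] as [u(x) - i u(ix)]. *)
exists (fun x => u x +i* - u ('i%C *: x))%C; split=> // -[a b] x y.
have abE : (a +i* b)%C = a%:C%C + b%:C%C * 'i%C by simpc.
have ii z : 'i%C *: ('i%C *: z) = (- 1)%:C%C *: z :> X.
  by rewrite scalerA -expr2 sqr_i rmorphN1.
have ir c z : 'i%C *: (c%:C%C *: z) = c%:C%C *: ('i%C *: z) :> X.
  by rewrite !scalerA mulrC.
rewrite abE scalerDl -(scalerA _ 'i%C) !scalerDr !ir ii !uD !uZr.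
by rewrite -abE; simpc; congr (_ +i* _)%C; ring.
Qed.

(** Rotating [x] by the unimodular scalar [|f x| / f x] keeps its norm and makes the value of [f]
    equal to [|f x|]. *)
Lemma real_part_functional_bounded (X : normedModType K) (f : {scalar X}) (C : R) :
  (forall x, real_part (f x) <= C * real_norm x) ->
  forall x, `|f x| <= of_real F C * `|x|.
Proof.
move=> fC x.
have [fx0|fx_neq0] := eqVneq (f x) 0.
  rewrite fx0 normr0 real_normE -rmorphM /= -(rmorph0 (of_real F)) ler_of_real.
  by have := fC x; rewrite fx0 raddf0.
pose a := `|f x| / f x.
have a1 : `|a| = 1 by rewrite /a normrM normfV normr_id divff ?normr_eq0.
have : `|f x| = f (a *: x) by rewrite linearZ/= /a divfK.
move=> fxE; rewrite -(real_partK (normr_ge0 (f x))) {1}fxE.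
rewrite real_normE -rmorphM ler_of_real.
by apply: le_trans (fC _) _; rewrite /real_norm normrZ a1 mul1r.
Qed.

Lemma closed_subspace_functional (X : normedModType K) (M : set X) (v : X) :
  closed_subspace M -> ~ M v ->
  exists f : {scalar X}, [/\ exists C : K, forall x, `|f x| <= C * `|x|,
    forall x, M x -> f x = 0 & f v = 1].
Proof.
move=> [[M0 Mlin] Mclosed] nMv.
have [d [d_gt0 dP]] : exists d : R, 0 < d /\ forall m, M m -> d <= real_norm (v - m).
  have := closed_openC Mclosed; rewrite openE => /(_ v nMv) /nbhs_ballP[e /= e_gt0 eP].
  exists (real_part e); split; first exact: real_part_gt0.
  move=> m Mm; rewrite leNgt; apply/negP => vm; apply: (eP m) => //.
  by rewrite -ball_normE /= real_normE -[e]real_partK ?ltr_of_real// ltW.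
pose VR := realification (of_real F) X.
pose p : VR -> R := fun x => d^-1 * @real_norm R F X x.
have [nD nZ] := real_norm_seminorm X.
(* This is the graph of [m + r v] mapped to [r]; it is dominated because [v] has distance at least
   [d] from [M]. *)
pose G : set (VR * R^o) := [set z | M (z.1 - z.2 *: (v : VR))].
have domG : dominated_graph p G.
  split.
  - by rewrite /G /= scale0r subr0.
  - move=> a [x r] [y s]; rewrite /G /= => Mx My.
    rewrite scalerDl opprD addrACA -scalerA -scalerBr.
    by rewrite realification_scaleE; apply: Mlin.
  - move=> [x r]; rewrite /G /p /= => Mx.
    have [r_le0|r_gt0] := leP r 0.
      apply: le_trans r_le0 _; rewrite mulr_ge0 ?invr_ge0 ?(ltW d_gt0)//.
      exact: (seminorm_ge0 (real_norm_seminorm X)).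
    rewrite mulrC ler_pdivlMr//.
    have MrN : M (- (r^-1 *: (x - r *: (v : VR)))).
      rewrite -scaleNr realification_scaleE -[_ *: _]addr0; exact: Mlin.
    have := dP _ MrN; rewrite opprK scalerBr scalerA mulVf ?gt_eqF// scale1r addrC subrK.
    by rewrite nZ gtr0_norm ?invr_gt0// mulrC ler_pdivlMr// mulrC.
have [||u [uG up]] := Hahn_Banach _ _ domG.
- by move=> x y; rewrite /p -mulrDr ler_pM2l ?invr_gt0.
- by move=> a x a_gt0; rewrite /p nZ gtr0_norm// mulrCA.
have [f fE] := real_part_functional u.
have fM x : M x -> f x = 0.
  move=> Mx; apply/eqP/negPn/negP => fx_neq0.
  have Max : M ((f x)^-1 *: x) by rewrite -[_ *: _]addr0; exact: Mlin.
  have := uG ((f x)^-1 *: x, 0).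
  rewrite /G /= scale0r subr0 => /(_ Max); rewrite -fE linearZ/= mulVf//.
  by rewrite -(rmorph1 (of_real F)) of_realK => /eqP; rewrite oner_eq0.
have fv_neq0 : f v != 0.
  apply/negP => /eqP fv0; have := uG (v, 1).
  rewrite /G /= scale1r subrr => /(_ M0); rewrite -fE fv0 raddf0.
  by move=> /eqP; rewrite eq_sym oner_eq0.
have f_bounded : forall x, `|f x| <= of_real F d^-1 * `|x|.
  by apply: real_part_functional_bounded => x; rewrite fE; apply: up.
(* Only the real part of [f v] is known to be [1], hence the normalisation. *)
exists ((f v)^-1 \*: f); split=> [|x Mx|] /=.
- exists (`|(f v)^-1| * of_real F d^-1) => x.
  by rewrite [_ *: _]/(_ * _) normrM -mulrA ler_wpM2l.
- by rewrite (fM _ Mx) scaler0.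
- exact: mulVf.
Qed.

End Functionals.

(** * Subspaces, finite spans and bounded projections *)

Section NormedSpace.
Context {K : numFieldType} {X : normedModType K}.
Implicit Types (A M N : set X) (x y v w : X) (vs : seq X).

Lemma closure_normP A x :
  closure A x <-> forall e, 0 < e -> exists2 y, A y & `|x - y| < e.
Proof.
split=> [clA e e_gt0|H B /nbhs_ballP[e /= e_gt0 eB]].
  have [|y [Ay xy]] := clA (ball x e); first exact: nbhsx_ballx.
  by exists y => //; rewrite -ball_normE in xy.
have [y Ay xy] := H e e_gt0.
by exists y; split=> //; apply: eB; rewrite -ball_normE.
Qed.

(** In a nonzero space the bound forces [0 <= C]; in the zero space [C] is arbitrary and [1]
    replaces it. *)
Lemma norm_bound_gt0 (g : X -> K) : (forall x, 0 <= g x) ->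
  (exists C, forall x, g x <= C * `|x|) ->
  exists2 C, 0 < C & forall x, g x <= C * `|x|.
Proof.
move=> g_ge0 [C gC].
have [[x0 x0_neq0]|X0] := pselect (exists x : X, x != 0).
  have C_ge0 : 0 <= C.
    rewrite -(pmulr_lge0 (x := `|x0|)) ?normr_gt0//.
    exact: le_trans (gC x0).
  exists (C + 1) => [|x]; first by rewrite ltr_wpDl.
  by apply: le_trans (gC x) _; rewrite ler_wpM2r// lerDl.
exists 1 => // x; have := gC x; have [->|x_neq0] := eqVneq x 0.
  by rewrite normr0 !mulr0.
by case: X0; exists x.
Qed.

Fixpoint in_span vs x : Prop :=
  if vs is v :: vs' then exists t : K, in_span vs' (x - t *: v) else x = 0.

Lemma in_spanP (a : K) vs x y :
  in_span vs x -> in_span vs y -> in_span vs (a *: x + y).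
Proof.
elim: vs x y => [|v vs IH] x y /=; first by move=> -> ->; rewrite scaler0 addr0.
move=> [t xt] [s ys]; exists (a * t + s).
rewrite scalerDl opprD addrACA -scalerA -scalerBr; exact: IH.
Qed.

Lemma in_span0 vs : in_span vs 0.
Proof.
by elim: vs => //= v vs IH; exists 0; rewrite scale0r subr0.
Qed.

Lemma in_spanN vs x : in_span vs x -> in_span vs (- x).
Proof. by move=> xs; rewrite -scaleN1r -[_ *: _]addr0; apply/in_spanP/in_span0. Qed.

Lemma in_spanD vs x y : in_span vs x -> in_span vs y -> in_span vs (x + y).
Proof. by move=> xs; rewrite -[x]scale1r; apply: in_spanP. Qed.

Lemma in_spanZ (a : K) vs x : in_span vs x -> in_span vs (a *: x).
Proof. by move=> xs; rewrite -[_ *: _]addr0; apply/in_spanP/in_span0. Qed.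

(** [C] is one plus the sum of the absolute values of the coefficients of [x]. It precedes [D], so
    that an operator can later be chosen with a tolerance adapted to [C]. *)
Lemma in_span_bound vs x : in_span vs x ->
  exists2 C : K, 0 < C & forall (D : {linear X -> X}) (e : K), 0 <= e ->
    (forall v, v \in vs -> `|D v| <= e) -> `|D x| <= C * e.
Proof.
elim: vs x => [|v vs IH] x /=.
  by move=> ->; exists 1 => // D e e_ge0 _; rewrite linear0 normr0 mul1r.
move=> [t /IH[C C_gt0 CP]]; exists (C + `|t|); first by rewrite ltr_wpDr.
move=> D e e_ge0 De; rewrite -(subrK (t *: v) x) linearD mulrDl.
apply: le_trans (ler_normD _ _) _; apply: lerD.
  by apply: CP => // u us; apply: De; rewrite in_cons us orbT.
by rewrite linearZ/= normrZ ler_wpM2l// De// mem_head.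
Qed.

Section Subspace.
Variable M : set X.
Hypothesis M_subspace : is_subspace M.

Lemma subspaceD x y : M x -> M y -> M (x + y).
Proof. by case: M_subspace => _ lin Mx; rewrite -[x]scale1r; apply: lin. Qed.

Lemma subspaceZ a x : M x -> M (a *: x).
Proof. by case: M_subspace => M0 lin Mx; rewrite -[_ *: _]addr0; apply: lin. Qed.

Lemma subspaceN x : M x -> M (- x).
Proof. by rewrite -scaleN1r; apply: subspaceZ. Qed.

Lemma subspaceB x y : M x -> M y -> M (x - y).
Proof. by move=> Mx /subspaceN; apply: subspaceD. Qed.

End Subspace.

(* Induction on [vs]: let [vh] solve the problem for [v + span vs]. If a member
   [M] not containing [vh] meets [x - t v + span vs], no smaller member meets
   [x - s v + span vs] with [s <> t], as subtracting would put [vh] in [M]; so the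
   solution for [x - t v] works. Otherwise every member meeting
   [x + span (v :: vs)] contains [vh], hence meets [x + span vs]. *)
Lemma chain_affine_span (L : set (set X)) vs x :
  (forall M, L M -> is_subspace M) ->
  (forall M N, L M -> L N -> M `<=` N \/ N `<=` M) ->
  exists2 w, in_span vs (x - w) &
    forall M y, L M -> M y -> in_span vs (x - y) -> M w.
Proof.
move=> sub chain; elim: vs x => [|v vs IH] x /=.
  exists x => [|M y LM My /eqP]; first by rewrite subrr.
  by rewrite subr_eq0 => /eqP ->.
have [vh vh_span vhP] := IH v.
have [[t [M [y [LM My yspan nMvh]]]]|none] := pselect (exists t M y,
    [/\ L M, M y, in_span vs (x - t *: v - y) & ~ M vh]).
  have [w w_span wP] := IH (x - t *: v).
  exists w => [|M' y' LM' My' [t' yspan']]; first by exists t; rewrite addrAC.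
  have Mw : M w by apply: wP My yspan.
  have [MM'|M'M] := chain _ _ LM LM'; first exact: MM'.
  have [tt'|tt'] := eqVneq t t'.
    by apply: (wP _ y' LM' My'); rewrite tt' addrAC.
  exfalso; apply: nMvh; apply: (vhP M ((t' - t)^-1 *: (w - y'))) => //.
    by apply: (subspaceZ (sub _ LM)); apply: (subspaceB (sub _ LM)) => //; apply: M'M.
  have t't : t' - t != 0 by rewrite subr_eq0 eq_sym.
  have -> : v - (t' - t)^-1 *: (w - y') =
      (t' - t)^-1 *: ((x - t *: v - w) - (x - y' - t' *: v)).
    have -> : x - t *: v - w - (x - y' - t' *: v) = (t' - t) *: v - (w - y').
      rewrite scalerBl !opprD !opprK !addrA [LHS](ACl (1*4*6*2*3*5))/=.
      by rewrite subrr add0r.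
    by rewrite [RHS]scalerBr scalerA mulVf// scale1r.
  apply: in_spanZ; apply: in_spanD => //; exact: in_spanN.
have [w w_span wP] := IH x.
exists w => [|M y LM My [t yspan]]; first by exists 0; rewrite scale0r subr0.
have Mvh : M vh.
  apply: contrapT => nMvh; apply: none; exists t, M, y; split=> //.
  by rewrite addrAC.
apply: (wP M (y + t *: vh)) => //.
  by apply: (subspaceD (sub _ LM)) => //; apply: subspaceZ => //; apply: sub.
have -> : x - (y + t *: vh) = (x - y - t *: v) + t *: (v - vh).
  by rewrite scalerBr addrA subrK opprD addrA.
by apply: in_spanD => //; apply: in_spanZ.
Qed.

(** The continuous map sending [x] to [x - f x *: v] carries [M + K v] into [M], hence its closure
    into the closed set [M]; its Lipschitz constant is [1 + C * |v|]. *)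
Lemma closed_subspace_add_line M v (f : {scalar X}) : closed_subspace M ->
  (exists C, forall x, `|f x| <= C * `|x|) -> (forall x, M x -> f x = 0) ->
  f v = 1 -> closed_subspace [set x | exists t, M (x - t *: v)].
Proof.
move=> [Msub Mcl] fC fM fv; split.
  split; first by exists 0; rewrite scale0r subr0; case: Msub.
  move=> a x y [t Mx] [s My]; exists (a * t + s).
  by rewrite scalerDl opprD addrACA -scalerA -scalerBr; apply: Msub.2.
have [C C_gt0 fb] := norm_bound_gt0 (fun x => normr_ge0 (f x)) fC.
have C'_gt0 : 0 < 1 + C * `|v| by rewrite ltr_pwDl ?mulr_ge0 ?(ltW C_gt0).
move=> x /closure_normP clx; exists (f x); apply: Mcl.
apply/closure_normP => e e_gt0.
have [|y [t Mt] xy] := clx (e / (1 + C * `|v|)); first by rewrite divr_gt0.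
exists (y - f y *: v).
  have := fM _ Mt; rewrite linearB linearZ/= fv mulr1 => /eqP.
  by rewrite subr_eq0 => /eqP ->.
have -> : x - f x *: v - (y - f y *: v) = (x - y) - f (x - y) *: v.
  by rewrite (raddfB f) scalerBl !opprD !opprK addrACA.
rewrite ltr_pdivlMr// in xy; apply: le_lt_trans xy.
rewrite mulrDr mulr1; apply: le_trans (ler_normB _ _) _; rewrite lerD2l.
by rewrite normrZ mulrA ler_wpM2r// mulrC.
Qed.

End NormedSpace.

Section ScalarsNormedSpace.
Context {R : realType} {F : scalar_kind}.
Local Notation K := (scalars R F).

(** The vectors of [vs] are absorbed one by one into [M], which stays closed; separation is applied
    once the list is exhausted. *)
Lemma functional_avoiding_span (X : normedModType K) (M : set X) vs w :
  closed_subspace M -> (forall m, M m -> ~ in_span vs (w - m)) ->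
  exists f : {scalar X}, [/\ exists C, forall x, `|f x| <= C * `|x|,
    forall x, M x -> f x = 0, forall v, v \in vs -> f v = 0 & f w = 1].
Proof.
elim: vs M => [|v vs IH] M Mcl wP.
  have [|f [fC fM fw]] := closed_subspace_functional (v := w) Mcl.
    by move=> /wP; apply; rewrite /= subrr.
  by exists f; split.
have [Mv|nMv] := pselect (M v).
  have [|f [fC fM fvs fw]] := IH M Mcl.
    by move=> m Mm ms; apply: (wP m) => //=; exists 0; rewrite scale0r subr0.
  exists f; split=> // u; rewrite in_cons => /orP[/eqP ->|]; [exact: fM|exact: fvs].
have [g [gC gM gv]] := closed_subspace_functional Mcl nMv.
have M'cl := closed_subspace_add_line Mcl gC gM gv.
have [|f [fC fM fvs fw]] := IH _ M'cl.
  move=> m [t Mt] ms; apply: (wP (m - t *: v)) => //=.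
  by exists t; rewrite opprB addrA addrAC addrK.
exists f; split=> // [x Mx|u].
  by apply: fM; exists 0; rewrite scale0r subr0.
rewrite in_cons => /orP[/eqP ->|]; last exact: fvs.
by apply: fM; exists 1; rewrite scale1r subrr; case: Mcl => -[].
Qed.

Lemma bounded_projection (X : completeNormedModType K) (N : set X) :
  closed_subspace N -> complemented N ->
  exists P : X -> X, [/\ linear P, exists C, forall x, `|P x| <= C * `|x|,
    forall x, N (P x) & forall x, N x -> P x = x].
Proof.
move=> [Nsub Ncl] [M [[Msub Mcl] NM NMT]].
have /choice[P PP] : forall x, exists y, N y /\ M (x - y).
  move=> x; have : [set: X] x by [].
  by rewrite -NMT => -[y Ny [z Mz <-]]; exists y; split=> //; rewrite addrAC subrr add0r.
have NM0 x : N x -> M x -> x = 0.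
  by move=> Nx Mx; have : (N `&` M) x by []; rewrite NM.
have Puniq x y : N y -> M (x - y) -> P x = y.
  move=> Ny My; have [NP MP] := PP x; apply/eqP; rewrite -subr_eq0; apply/eqP.
  apply: NM0; first exact: subspaceB.
  have -> : P x - y = (x - y) - (x - P x) by rewrite opprB [RHS]addrC subrKA.
  exact: subspaceB.
have P_lin : linear P.
  move=> a x y; have [[NPx MPx] [NPy MPy]] := (PP x, PP y).
  apply: Puniq; first exact: Nsub.2.
  by rewrite opprD addrACA -scalerBr; apply: Msub.2.
exists P; split=> //; last first.
- by move=> x Nx; apply: Puniq => //; rewrite subrr; case: Msub.
- by move=> x; case: (PP x).
pose VR := realification (of_real F) X.
have PR_lin : linear (P : VR -> VR).
  by move=> a x y; rewrite realification_scaleE P_lin.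
pose PM := GRing.isLinear.Build _ _ _ _ (P : VR -> VR) PR_lin.
pose PL : {linear VR -> VR} := HB.pack (P : VR -> VR) PM.
have [|C CP] := closed_graph (T := PL) (real_norm_seminorm X)
  (real_norm_seminorm X) (@real_norm_complete R F X) (@real_norm_complete R F X).
  (* If [x] tends to [0] and [P x] to [y], then [y] is in [N] as a limit of [P x], and [- y] is in
     [M] as a limit of [x - P x]; so [y = 0]. *)
  move=> y yP.
  have approx (e : K) : 0 < e -> exists x, `|x| < e /\ `|P x - y| < e.
    move=> e_gt0; have [x [xe Pxe]] := yP _ (real_part_gt0 e_gt0).
    exists x; rewrite !real_normE -(real_partK (ltW e_gt0)) !ltr_of_real.
    by split.
  have Ny : N y.
    apply/Ncl/closure_normP => e /approx[x [_ xe]].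
    by exists (P x); [case: (PP x) | rewrite distrC].
  have My : M y.
    rewrite -[y]opprK; apply: (subspaceN Msub); apply/Mcl/closure_normP => e e_gt0.
    have [|x [xe Pxe]] := approx (e / 2); first by rewrite divr_gt0.
    exists (x - P x); first by case: (PP x).
    have -> : - y - (x - P x) = (P x - y) - x by rewrite opprB addrC addrAC.
    by rewrite [e]splitr; apply: le_lt_trans (ler_normB _ _) _; apply: ltrD.
  by rewrite (NM0 y) ?(seminorm0 (real_norm_seminorm X)).
exists (of_real F C) => x.
by rewrite !real_normE -rmorphM ler_of_real; apply: CP.
Qed.

End ScalarsNormedSpace.

(** * Nests and the span of idempotents *)

Section NestTheory.
Context {K : numFieldType} {X : normedModType K} (L : nest X).
Implicit Types (M N : set X) (x y : X).

Lemma nest_closed M : L M -> closed_subspace M.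
Proof. by have [[sub _ _ _] _] := nestP L => /sub. Qed.

Lemma nest_subspace M : L M -> is_subspace M.
Proof. by move=> /nest_closed[]. Qed.

Lemma nest_chain M N : L M -> L N -> M `<=` N \/ N `<=` M.
Proof. by have [_] := nestP L; apply. Qed.

Definition nest_hull x : set X := \bigcap_(M in [set M | L M /\ M x]) M.

Lemma nest_hull_mem x : nest_hull x x.
Proof. by move=> M []. Qed.

Lemma nest_hull_nest x : L (nest_hull x).
Proof. by have [[_ _ cap _] _] := nestP L; apply: cap => M []. Qed.

Lemma nest_hull_min M x : L M -> M x -> nest_hull x `<=` M.
Proof. by move=> LM Mx y; apply. Qed.

Lemma nest_proper_hull M x : L M -> ~ M x -> M `<` nest_hull x.
Proof.
move=> LM nMx; have nhM : ~ (nest_hull x `<=` M).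
  by move=> /(_ _ (nest_hull_mem (x := x))).
by split=> //; have [|/nhM] := nest_chain LM (nest_hull_nest x).
Qed.

Lemma nest_pred_nest N : L (nest_pred L N).
Proof. by have [[_ _ _ sup] _] := nestP L; apply: sup => M []. Qed.

Lemma sub_nest_pred M N : L M -> M `<` N -> M `<=` nest_pred L N.
Proof.
move=> LM MN x Mx; apply: subset_closure; exists 1, (fun=> 1), (fun=> x).
by split; [move=> _; exists M | rewrite big_ord1 scale1r].
Qed.

Lemma nest_pred_sub N : L N -> nest_pred L N `<=` N.
Proof.
move=> LN; have [Nsub Ncl] := nest_closed LN.
apply: subset_trans Ncl; apply: closure_subset => _ [n [a [v [vN ->]]]].
apply: big_ind => [|y z|i _]; [by case: Nsub | exact: subspaceD |].
by apply: subspaceZ => //; have [M [_ [+ _]]] := vN i; apply.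
Qed.

(** The union of the members strictly inside [N] is already a subspace, because they form a chain;
    it is nonempty because it contains [[set 0]]. *)
Lemma nest_pred_approx N x (e : K) : N <> [set 0] -> L N ->
  nest_pred L N x -> 0 < e ->
  exists M z, [/\ L M, M `<` N, M z & `|x - z| < e].
Proof.
move=> N_neq0 LN /closure_normP clx /clx[z [n [a [v [vN ->]]]] xz].
pose U := \bigcup_(M in [set M | L M /\ M `<` N]) M.
suff [M [LM MN] Mz] : U (\sum_(i < n) a i *: v i) by exists M, (\sum_(i < n) a i *: v i).
have [[_ [L0 _] _ _] _] := nestP L.
apply: (big_ind U) => [|y1 y2 [M1 [LM1 M1N] My1] [M2 [LM2 M2N] My2]|i _].
- exists [set 0] => //; split=> //; split=> [_ ->|N0].
    by case: (nest_subspace LN).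
  apply: N_neq0; apply/seteqP; split=> // _ ->; by case: (nest_subspace LN).
- have [M12|M21] := nest_chain LM1 LM2.
    by exists M2 => //; apply: (subspaceD (nest_subspace LM2)) => //; apply: M12.
  by exists M1 => //; apply: (subspaceD (nest_subspace LM1)) => //; apply: M21.
- have [M [LM MN] Mv] := vN i.
  by exists M => //; apply: (subspaceZ (nest_subspace LM)).
Qed.

Lemma nest_algI (T : X -> X) : linear T ->
  (exists C, forall x, `|T x| <= C * `|x|) ->
  (forall N x, L N -> N x -> N (T x)) ->
  exists a : nest_alg L, forall x, a x = T x.
Proof.
move=> T_lin T_bounded T_inv.
have bT : T \in @bounded_linear K X by rewrite inE.
have iT : BoundedOp bT \in leaves_invariant L.
  by rewrite inE => N LN _ [x Nx <-]; apply: T_inv.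
by exists (NestAlg iT).
Qed.

Lemma nest_alg_ext (a b : nest_alg L) : (forall x, a x = b x) -> a = b.
Proof. by move=> ab; do 2 apply: val_inj; apply/funext. Qed.

Lemma nest_alg_inv (a : nest_alg L) N x : L N -> N x -> N (a x).
Proof.
by move=> LN Nx; have := nest_algP a; rewrite inE => /(_ _ LN); apply; exists x.
Qed.

End NestTheory.

Section IdempotentSpan.
Context {R : realType} {F : scalar_kind}.
Local Notation K := (scalars R F).
Context {X : completeNormedModType K} {L : nest X}.
Hypothesis L_compl : forall N, L N -> nest_pred L N = N -> complemented N.
Variable J : set (nest_alg L).
Hypothesis J_lin : forall (a : K) S T, J S -> J T -> J (a *: S + T).
Hypothesis J_idem : forall P, P * P = P -> J P.
Implicit Types (f : {scalar X}) (x y w : X).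

Let JB S T : J S -> J T -> J (S - T).
Proof. by move=> JS JT; rewrite addrC -scaleN1r; apply: J_lin. Qed.

Lemma idempotent_in (T : X -> X) : linear T ->
  (exists C, forall x, `|T x| <= C * `|x|) ->
  (forall N x, L N -> N x -> N (T x)) -> (forall x, T (T x) = T x) ->
  exists2 a : nest_alg L, J a & forall x, a x = T x.
Proof.
move=> T_lin T_bd T_inv TT; have [a aE] := nest_algI T_lin T_bd T_inv.
exists a => //; apply: J_idem; apply: nest_alg_ext => x.
by rewrite -[LHS]/(a (a x)) !aE.
Qed.

Lemma rank_one_linear f y : linear (fun x => f x *: y).
Proof. by move=> a u v; rewrite linearP scalerDl scalerA. Qed.

Lemma rank_one_bounded f y : (exists C, forall x, `|f x| <= C * `|x|) ->
  exists C, forall x, `|f x *: y| <= C * `|x|.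
Proof.
move=> [C fC]; exists (C * `|y|) => x.
by rewrite normrZ mulrAC ler_wpM2r.
Qed.

Lemma rank_one_idempotent_in f y : (exists C, forall x, `|f x| <= C * `|x|) ->
  (forall N, L N -> ~ N y -> forall x, N x -> f x = 0) -> f y = 1 ->
  exists2 a : nest_alg L, J a & forall x, a x = f x *: y.
Proof.
move=> f_bd fN fy; apply: idempotent_in.
- exact: rank_one_linear.
- exact: rank_one_bounded.
- move=> N x LN Nx; have [Ny|/fN fN0] := pselect (N y).
    exact: (subspaceZ (nest_subspace LN)).
  by rewrite fN0// scale0r; case: (nest_subspace LN).
- by move=> x; rewrite linearZ/= fy mulr1.
Qed.

(** With [c = 1 - f y], the functional [f] is [1] at both [w] and [y + c *: w]. Each gives a
    rank-one idempotent, and the first, times [c], is subtracted from the second. *)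
Lemma rank_one_in f y w : (exists C, forall x, `|f x| <= C * `|x|) ->
  (forall N, L N -> N w -> N y) ->
  (forall N, L N -> ~ N w -> forall x, N x -> f x = 0) -> f w = 1 ->
  exists2 a : nest_alg L, J a & forall x, a x = f x *: y.
Proof.
move=> f_bd wy fN fw; pose c := 1 - f y.
have [||a Ja aE] := rank_one_idempotent_in (y := y + c *: w) f_bd.
- move=> N LN nN; apply: (fN _ LN) => Nw; apply: nN.
  by apply: (subspaceD (nest_subspace LN)); [exact: wy | exact: (subspaceZ (nest_subspace LN))].
- by rewrite linearD linearZ/= fw mulr1 addrC subrK.
have [b Jb bE] := rank_one_idempotent_in f_bd fN fw.
exists ((- c) *: b + a); first exact: J_lin.
move=> x; rewrite -[LHS]/((- c) *: b x + a x) aE bE scalerDr scaleNr.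
by rewrite !scalerA mulrC addrC addrK.
Qed.

(* With [N] the least member of the nest containing [y]: if [y] is not in [N_-],
   write [f = (f + g) - g] with [g(y) = 1] and [g = 0] on [N_-]; otherwise
   [N_- = N] and [f(-) y = (P + f(-) y) - P] for a projection [P] onto [N]. *)
Lemma rank_one_null_in f M y : (exists C, forall x, `|f x| <= C * `|x|) ->
  L M -> M y -> (forall x, M x -> f x = 0) ->
  exists2 a : nest_alg L, J a & forall x, a x = f x *: y.
Proof.
move=> f_bd LM My fM; pose N := nest_hull L y.
have LN : L N := nest_hull_nest L y.
have NM : N `<=` M by apply: nest_hull_min.
have Ny : N y := @nest_hull_mem _ _ L y.
have fN x : N x -> f x = 0 by move=> /NM/fM.
have [pNy|npNy] := pselect (nest_pred L N y); last first.
  have [g [g_bd gN gy]] := closed_subspace_functional (nest_closed (nest_pred_nest L N)) npNy.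
  have gN' N' : L N' -> ~ N' y -> forall x, N' x -> g x = 0.
    move=> LN' nN'y x N'x; apply: gN; apply: sub_nest_pred N'x => //.
    exact: nest_proper_hull.
  have [b Jb bE] := rank_one_idempotent_in g_bd gN' gy.
  have [||| a Ja aE] := rank_one_idempotent_in (f := f \+ g) (y := y).
  - have [[C1 fC] [C2 gC]] := (f_bd, g_bd); exists (C1 + C2) => x /=.
    by rewrite mulrDl; apply: le_trans (ler_normD _ _) _; apply: lerD.
  - move=> N' LN' nN'y x N'x /=; rewrite (gN' N')// addr0; apply: fN.
    by case: (nest_proper_hull LN' nN'y) => + _; apply.
  - by rewrite /= gy fM// add0r.
  exists (a - b); first exact: JB.
  by move=> x; rewrite -[LHS]/(a x - b x) aE bE /= scalerDl addrK.
have pNN : nest_pred L N = N.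
  apply/seteqP; split; first exact: nest_pred_sub.
  by apply: nest_hull_min => //; exact: nest_pred_nest.
have [P [P_lin P_bd PN PNid]] := bounded_projection (nest_closed LN) (L_compl LN pNN).
have P_inv N' x : L N' -> N' x -> N' (P x).
  move=> LN' N'x; have [N'N|NN'] := nest_chain LN' LN; first by rewrite PNid//; apply: N'N.
  by apply: NN'; exact: PN.
have [b Jb bE] : exists2 b : nest_alg L, J b & forall x, b x = P x.
  by apply: idempotent_in => // x; rewrite PNid.
pose Q x := P x + f x *: y.
have [||||a Ja aE] := idempotent_in (T := Q).
- by move=> c u v; rewrite /Q P_lin rank_one_linear scalerDr addrACA.
- have [[C1 PC] [C2 fC]] := (P_bd, rank_one_bounded y f_bd).
  exists (C1 + C2) => x.
  by rewrite mulrDl; apply: le_trans (ler_normD _ _) _; apply: lerD.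
- move=> N' x LN' N'x; apply: (subspaceD (nest_subspace LN')); first exact: P_inv.
  have [N'N|NN'] := nest_chain LN' LN.
    have -> : f x = 0 by apply: fN; apply: N'N.
    by rewrite scale0r; case: (nest_subspace LN').
  by apply: (subspaceZ (nest_subspace LN')); apply: NN'.
(* The range of [Q] lies in [N], where [P] is the identity and [f] vanishes. *)
- move=> x; rewrite /Q; have NQ : N (P x + f x *: y).
    have Nsub := nest_subspace LN.
    by apply: (subspaceD Nsub) => //; apply: (subspaceZ Nsub).
  by rewrite PNid// (fN (P x + _))// scale0r addr0.
exists (a - b); first exact: JB.
by move=> x; rewrite -[LHS]/(a x - b x) aE bE /Q addrC addKr.
Qed.

End IdempotentSpan.

(** * Density in the strong operator topology *)

Lemma initial_cvgP (S : choiceType) (T : topologicalType) (f : S -> T)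
    (G : set_system S) (s : S) : Filter G ->
  G --> (s : initial_topology f) <-> f @ G --> f s.
Proof.
move=> FG; split=> [Gs|fGs A [_ [[B Bop <-] Bfs] sBA]].
  by apply: cvg_comp Gs _; apply: initial_continuous.
by apply: filterS sBA _; apply: fGs; apply: open_nbhs_nbhs.
Qed.

Section Density.
Context {R : realType} {F : scalar_kind}.
Local Notation K := (scalars R F).
Context {X : completeNormedModType K} {L : nest X}.

Lemma nest_sot_cvgP (G : set_system (nest_alg L)) (a : nest_alg L) : Filter G ->
  G --> (a : nest_sot L) <-> forall x, (fun T : nest_alg L => T x) @ G --> a x.
Proof.
move=> FG; rewrite initial_cvgP initial_cvgP pointwise_cvgP.
by split.
Qed.

Hypothesis L_compl : forall N, L N -> nest_pred L N = N -> complemented N.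
Variable J : set (nest_alg L).
Hypothesis J_lin : forall (a : K) S T, J S -> J T -> J (a *: S + T).
Hypothesis J_idem : forall P, P * P = P -> J P.

Lemma approx_at_chain_minimum (B : nest_alg L) (vs : seq X) (x w : X) (e : K) :
  w != 0 -> in_span vs (x - w) ->
  (forall M y, L M -> M y -> in_span vs (x - y) -> M w) -> 0 < e ->
  exists T, [/\ J T, forall v, v \in vs -> T v = 0 & `|T w - B w| < e].
Proof.
move=> w_neq0 xw wP e_gt0; pose N := nest_hull L w.
have LN : L N := nest_hull_nest L w.
have Nw : N w := @nest_hull_mem _ _ L w.
(* Such an [m] would also differ from [x] by an element of the span, so [wP] would put [w] in
   [M]. *)
have avoid M : L M -> ~ M w -> forall m, M m -> ~ in_span vs (w - m).
  move=> LM nMw m Mm wm; apply: nMw; apply: (wP M m) => //.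
  by rewrite -(subrKA w); apply: in_spanD.
have NB : N (B w) := nest_alg_inv B LN Nw.
have Lp := nest_pred_nest L N.
have [pNw|npNw] := pselect (nest_pred L N w); last first.
  have [f [f_bd fN fvs fw]] :=
    functional_avoiding_span (nest_closed Lp) (avoid _ Lp npNw).
  have [||T JT TE] := rank_one_in J_lin J_idem (y := B w) (w := w) f_bd _ _ fw.
  - by move=> N' LN' N'w; apply: (nest_hull_min LN' N'w).
  - move=> N' LN' nN'w z N'z; apply: fN; apply: sub_nest_pred N'z => //.
    exact: nest_proper_hull.
  exists T; split=> // [v /fvs fv|]; first by rewrite TE fv scale0r.
  by rewrite TE fw scale1r subrr normr0.
have N_neq0 : N <> [set 0].
  by move=> N0; move: Nw; rewrite N0 => /= w0; rewrite w0 eqxx in w_neq0.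
have [M [z [LM MN Mz Bz]]] := nest_pred_approx N_neq0 LN (nest_hull_min Lp pNw NB) e_gt0.
have nMw : ~ M w by move=> Mw; case: MN => _; apply; apply: nest_hull_min.
have [f [f_bd fM fvs fw]] := functional_avoiding_span (nest_closed LM) (avoid _ LM nMw).
have [T JT TE] := rank_one_null_in L_compl J_lin J_idem f_bd LM Mz fM.
exists T; split=> // [v /fvs fv|]; first by rewrite TE fv scale0r.
by rewrite TE fw scale1r distrC.
Qed.

(** An approximation [T] on [vs] is corrected at [w] without changing it on [vs]. Since [x - w] is
    in the span of [vs], the error at [x] is at most [C * e'] plus the error at [w]. *)
Lemma idempotent_span_dense (A : nest_alg L) (vs : seq X) (e : K) : 0 < e ->
  exists2 T, J T & forall v, v \in vs -> `|T v - A v| < e.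
Proof.
elim: vs e => [|x vs IH] e e_gt0.
  by exists 0 => //; apply: J_idem; rewrite mulr0.
have [w xw wP] := chain_affine_span vs x (@nest_subspace _ _ L) (@nest_chain _ _ L).
have [C C_gt0 CP] := in_span_bound xw.
have C1_gt0 : 0 < 1 + C by rewrite ltr_pwDl// ltW.
(* This choice gives both [C * e' <= e / 2] and [e' < e]. *)
pose e' := e / 2 / (1 + C).
have e'_gt0 : 0 < e' by rewrite !divr_gt0.
have e2_gt0 : 0 < e / 2 by rewrite divr_gt0.
have Ce' : C * e' <= e / 2.
  by rewrite /e' mulrCA ler_piMr ?(ltW e2_gt0)// ler_pdivrMr// mul1r lerDr.
have e'e : e' < e.
  have : e' <= e / 2 by rewrite ler_pdivrMr// ler_peMr ?(ltW e2_gt0)// lerDl ltW.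
  by move=> /le_lt_trans; apply; rewrite ltr_pdivrMr// ltr_pMr// ltr1n.
have [T JT TA] := IH _ e'_gt0.
suff [T' [JT' T'T T'w]] : exists T', [/\ J T',
    forall v, v \in vs -> T' v = T v & `|T' w - A w| < e / 2].
  exists T' => // v; rewrite in_cons => /orP[/eqP ->|vvs]; last first.
    by rewrite T'T//; apply: lt_trans e'e; apply: TA.
  pose D : bounded_op X := nest_alg_op (T' - A).
  have DE u : D u = T' u - A u by [].
  have bound : `|D (x - w)| <= C * e'.
    apply: CP (ltW e'_gt0) _ => u uvs.
    by have /ltW := TA u uvs; rewrite -(T'T u uvs).
  rewrite -DE -(subrK w x) linearD [e]splitr.
  apply: le_lt_trans (ler_normD _ _) _; apply: ler_ltD => //.
  exact: le_trans Ce'.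
have [w0|w_neq0] := eqVneq w 0.
  exists T; split=> //; have T0 (S : nest_alg L) : S 0 = 0 := linear0 (nest_alg_op S).
  by rewrite w0 !T0 subrr normr0.
have [S [JS Svs Sw]] := approx_at_chain_minimum (A - T) w_neq0 xw wP e2_gt0.
exists (1 *: S + T); split; first exact: J_lin.
  by move=> v vvs; rewrite -[LHS]/(1 *: S v + T v) Svs// scaler0 add0r.
rewrite -[X in X - _]/(1 *: S w + T w) scale1r.
by move: Sw; rewrite -[(A - T) w]/(A w - T w) opprB addrA.
Qed.

Lemma idempotent_span_sot_dense (A : nest_alg L) :
  exists G : set_system (nest_alg L),
    [/\ ProperFilter G, G J & G --> (A : nest_sot L)].
Proof.
pose D := [set i : seq X * K | 0 < i.2].
pose B (i : seq X * K) := [set T | J T /\ forall v, v \in i.1 -> `|T v - A v| < i.2].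
have FG : ProperFilter (filter_from D B).
  apply: filter_from_proper => [|[vs e] /= e_gt0]; last first.
    by have [T JT TA] := idempotent_span_dense A vs e_gt0; exists T.
  apply: filter_from_filter; first by exists ([::], 1); exact: ltr01.
  move=> [vs1 e1] [vs2 e2] /= e1_gt0 e2_gt0.
  suff [e [e_gt0 le1 le2]] : exists e, [/\ 0 < e, e <= e1 & e <= e2].
    exists (vs1 ++ vs2, e) => // T [JT TA]; split; split=> // v vvs.
      by apply: lt_le_trans le1; apply: TA; rewrite mem_cat vvs.
    by apply: lt_le_trans le2; apply: TA; rewrite mem_cat vvs orbT.
  (* The order on [K] may be partial, but positive scalars are real and so comparable. *)
  have [e12|/ltW e21] := real_leP (gtr0_real e1_gt0) (gtr0_real e2_gt0).
    by exists e1; split.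
  by exists e2; split.
exists (filter_from D B); split=> //.
  by exists ([::], 1) => [|T []//]; exact: ltr01.
apply/nest_sot_cvgP => x; apply/cvgrPdist_lt => e e_gt0.
exists ([:: x], e) => // T [_ TA]; rewrite /= distrC; apply: TA.
by rewrite mem_seq1.
Qed.

End Density.

(** * From idempotents to the whole nest algebra by continuity *)

Lemma sot_continuous_mul_of_idempotents (R : realType) (F : scalar_kind)
    (X : completeNormedModType (scalars R F)) (L : nest X)
    (delta : {linear nest_alg L -> nest_alg L}) (c : nest_alg L) :
  (forall N, L N -> nest_pred L N = N -> complemented N) ->
  continuous (delta : nest_sot L -> nest_sot L) ->
  (forall P : nest_alg L, P * P = P -> delta P = P * c) ->
  forall a : nest_alg L, delta a = a * c.
Proof.
move=> L_compl delta_cont deltaP a.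
(* Through [deltaP], the subspace [J] becomes the set of [T] with [delta T = T * c]. *)
have [|G [FG GJ Ga]] := idempotent_span_sot_dense L_compl _ deltaP a.
  move=> k S T /= deltaS deltaT; rewrite linearP deltaS deltaT.
  by apply: nest_alg_ext => x.
apply: nest_alg_ext => x.
have deltaGa : delta @ G --> (delta a : nest_sot L).
  by apply: cvg_comp Ga _; exact: delta_cont.
have lim1 : (fun T => delta T x) @ G --> delta a x.
  by have /nest_sot_cvgP/(_ x) := deltaGa.
(* On [J] the value [delta T x] is [T (c x)], so convergence at the single vector [c x] suffices. *)
have lim2 : (fun T => delta T x) @ G --> a (c x).
  have /nest_sot_cvgP/(_ (c x)) Gacx := Ga.
  by apply: cvg_trans Gacx; apply: near_eq_cvg; apply: filterS GJ => T /= ->.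
exact: norm_cvg_unique lim1 lim2.
Qed.

Theorem proposition2p8 (R : realType) (F : scalar_kind)
  (X : completeNormedModType (scalars R F)) (L : nest X)
  (L_compl : forall N, L N -> nest_pred L N = N -> complemented N)
  (delta : {linear nest_alg L -> nest_alg L})
  (delta_cont : continuous (delta : nest_sot L -> nest_sot L)) :
  ((forall P : nest_alg L, P * P = P -> delta P = (P * delta P) *+ 2) ->
    forall a : nest_alg L, delta a = 0) /\
  ((forall P : nest_alg L, P * P = P ->
      delta P = (P * delta P) *+ 2 - P * delta 1) ->
    forall a : nest_alg L, delta a = a * delta 1).
Proof.
split=> deltaP a.
  rewrite -(mulr0 a); apply: sot_continuous_mul_of_idempotents => // P PP.
  rewrite mulr0; have deltaPE := deltaP _ PP.
  suff PdP : P * delta P = 0 by rewrite deltaPE PdP mul0rn.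
  have := congr1 (fun T => P * T) deltaPE.
  rewrite mulrnAr mulrA PP mulr2n => /eqP.
  by rewrite -subr_eq0 opprD addrA subrr sub0r oppr_eq0 => /eqP.
apply: sot_continuous_mul_of_idempotents => // P PP; have deltaPE := deltaP _ PP.
have PdP : P * delta P = P * delta 1.
  have := congr1 (fun T => P * T) deltaPE.
  rewrite mulrBr mulrnAr !mulrA PP mulr2n -addrA => /esym/eqP.
  by rewrite -subr_eq0 addrAC subrr add0r subr_eq0 => /eqP.
by rewrite deltaPE PdP mulr2n addrK.
Qed.
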